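(* Let $G$ be an opposite-semicube-isomorphic partial cube that is not antipodal, and let $X$ be an antipodal opposite-semicube-isomorphic partial cube. Then the Cartesian product $G\,\square\,X$ is an opposite-semicube-isomorphic partial cube that is not antipodal.
   Context: All graphs are undirected, connected, simple and finite; $d_G$ is the usual shortest-path distance. The Cartesian product $G\,\square\,X$ has vertex set $V(G)\times V(X)$, with $(g,h)$ adjacent to $(g',h')$ iff either $gg'\in E(G)$ and $h=h'$, or $g=g'$ and $hh'\in E(X)$. A partial cube is a graph isomorphic to an isometric subgraph of some hypercube (a subgraph $H$ of $Q$ is isometric if $d_H(x,y)=d_Q(x,y)$ for all $x,y\in V(H)$). The Djokovi\'c–Winkler relation on $E(G)$ is: $uv\,\Theta\,xy$ iff $d_G(u,x)+d_G(v,y)\ne d_G(u,y)+d_G(v,x)$; in a partial cube it is an equivalence relation, and its classes $E_1,\dots,E_d$ are the $\Theta$-classes. For a $\Theta$-class $E_i$ and an edge $xy\in E_i$, the two (opposite) semicubes associated with $E_i$ are $W_i^0=\{a\in V(G): d_G(x,a)<d_G(y,a)\}$ and $W_i^1=\{a\in V(G): d_G(y,a)<d_G(x,a)\}$ (independent of the choice of $xy\in E_i$ up to interchanging the labels $0,1$). A partial cube $G$ is opposite-semicube-isomorphic if $G[W_i^0]\cong G[W_i^1]$ (induced subgraphs) for every $i\in\{1,\dots,d\}$. A vertex $y$ is a relative antipode of $x$ in $G$ if $d_G(x,y)\ge d_G(x,z)$ for every neighbor $z$ of $y$. $G$ is antipodal if every vertex has exactly one relative antipode. *)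

(* Defs.v *)
From mathcomp Require Import all_boot.

Set Implicit Arguments.
Unset Strict Implicit.
Unset Printing Implicit Defensive.

Record sgraph := SGraph {
  svertex :> finType;
  sedge : rel svertex;
  sedge_sym : symmetric sedge;
  sedge_irrefl : irreflexive sedge }.

Arguments sedge {s} : rename.

Notation "x -- y" := (sedge x y) (at level 30, no associativity).

(* By convention the graph without vertices is not connected. *)
Definition connected (G : sgraph) : Prop :=
  0 < #|G| /\ forall x y : G, connect sedge x y.

Definition walk (G : sgraph) (n : nat) (x y : G) : bool :=
  [exists p : n.-tuple G, path sedge x p && (last x p == y)].

(* The least length of a walk from x to y.  A shortest walk has fewer than
   #|G| edges, so the search is bounded; the value is #|G| exactly when no
   walk exists, which does not happen in a connected graph. *)
Definition dist (G : sgraph) (x y : G) : nat :=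
  find (fun n => walk n x y) (iota 0 #|G|).

Definition isomorphic (G H : sgraph) : Prop :=
  exists f : G -> H, bijective f /\ forall x y : G, f x -- f y = x -- y.

(* Subgraphs, not necessarily induced. *)
Record subgraph (G : sgraph) := Subgraph {
  sub_verts : {set G};
  sub_edge : rel G;
  sub_edge_sym : symmetric sub_edge;
  sub_edgeP : forall x y : G,
    sub_edge x y -> [&& x \in sub_verts, y \in sub_verts & x -- y] }.

Section SubgraphAsGraph.
Variables (G : sgraph) (H : subgraph G).

Definition sgraph_of_edge : rel {x : G | x \in sub_verts H} :=
  fun x y => sub_edge H (val x) (val y).

Lemma sgraph_of_sym : symmetric sgraph_of_edge.
Proof. by move=> x y; apply: sub_edge_sym. Qed.

Lemma sgraph_of_irrefl : irreflexive sgraph_of_edge.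
Proof.
by move=> x; apply/negP => /sub_edgeP /and3P[_ _]; rewrite sedge_irrefl.
Qed.

Definition sgraph_of : sgraph := SGraph sgraph_of_sym sgraph_of_irrefl.

Definition isometric : Prop :=
  forall x y : sgraph_of, dist x y = dist (val x) (val y).

End SubgraphAsGraph.

Section InducedSubgraph.
Variables (G : sgraph) (S : {set G}).

Definition induced_edge : rel G :=
  fun x y => [&& x \in S, y \in S & x -- y].

Lemma induced_edge_sym : symmetric induced_edge.
Proof. by move=> x y; rewrite /induced_edge sedge_sym andbCA. Qed.

Lemma induced_edgeP (x y : G) :
  induced_edge x y -> [&& x \in S, y \in S & x -- y].
Proof. by []. Qed.

Definition induced : sgraph :=
  sgraph_of (Subgraph induced_edge_sym induced_edgeP).

End InducedSubgraph.

Section Hypercube.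
Variable n : nat.

Definition hypercube_edge : rel {ffun 'I_n -> bool} :=
  fun x y => #|[set i | x i != y i]| == 1.

Lemma hypercube_edge_sym : symmetric hypercube_edge.
Proof.
move=> x y; rewrite /hypercube_edge; congr (_ == _); apply: eq_card => i.
by rewrite !inE eq_sym.
Qed.

Lemma hypercube_edge_irrefl : irreflexive hypercube_edge.
Proof.
move=> x; rewrite /hypercube_edge (_ : [set i | _] = set0) ?cards0 //.
by apply/setP => i; rewrite !inE eqxx.
Qed.

Definition hypercube : sgraph :=
  SGraph hypercube_edge_sym hypercube_edge_irrefl.

End Hypercube.

Section CartesianProduct.
Variables G X : sgraph.

Definition cartesian_edge : rel (G * X) :=
  fun u v => (u.1 -- v.1) && (u.2 == v.2) || (u.1 == v.1) && (u.2 -- v.2).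

Lemma cartesian_edge_sym : symmetric cartesian_edge.
Proof.
move=> u v; rewrite /cartesian_edge.
by rewrite (sedge_sym u.1) (sedge_sym u.2) (eq_sym u.1) (eq_sym u.2).
Qed.

Lemma cartesian_edge_irrefl : irreflexive cartesian_edge.
Proof. by move=> u; rewrite /cartesian_edge !sedge_irrefl andbF. Qed.

Definition cartesian_product : sgraph :=
  SGraph cartesian_edge_sym cartesian_edge_irrefl.

End CartesianProduct.

(* Graphs are connected by convention; this has to be required of H because
   the value of [dist] is junk between distinct components. *)
Definition partial_cube (G : sgraph) : Prop :=
  exists (n : nat) (H : subgraph (hypercube n)),
    [/\ connected (sgraph_of H), isometric H & isomorphic G (sgraph_of H)].

(* Edges as unordered pairs. *)
Definition edges (G : sgraph) : {set {set G}} :=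
  [set [set p.1; p.2] | p : G * G & p.1 -- p.2].

(* The Djokovic-Winkler relation; the inequality is insensitive to exchanging
   u with v or x with y, so the orientation chosen for e and f is immaterial. *)
Definition Theta (G : sgraph) : rel {set G} :=
  fun e f => [exists u : G, exists v : G, exists x : G, exists y : G,
    [&& e == [set u; v], f == [set x; y]
      & dist u x + dist v y != dist u y + dist v x]].

Definition Theta_classes (G : sgraph) : {set {set {set G}}} :=
  equivalence_partition (@Theta G) (edges G).

Definition semicube (G : sgraph) (x y : G) : {set G} :=
  [set a | dist x a < dist y a].

(* The two semicubes of a class do not depend, up to exchange, on the edge
   xy chosen in it, so all choices of xy may be quantified over. *)
Definition opposite_semicube_isomorphic (G : sgraph) : Prop :=
  forall E : {set {set G}}, E \in Theta_classes G ->
  forall x y : G, [set x; y] \in E ->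
    isomorphic (induced (semicube x y)) (induced (semicube y x)).

Definition relative_antipode (G : sgraph) (x y : G) : Prop :=
  forall z : G, y -- z -> dist x z <= dist x y.

Definition antipodal (G : sgraph) : Prop :=
  forall x : G, exists! y : G, relative_antipode x y.

(* Main.v *)
Require Import Defs.
From mathcomp Require Import all_boot.

(** Walks in a product project to walks in the factors whose lengths add up, so
    distances add up.  Hence isometric embeddings of the factors into hypercubes
    concatenate to an isometric embedding of the product, the semicubes of the
    product are the cylinders over the semicubes of the factors, and [(y, k)] is
    a relative antipode of [(x, h)] iff [y] is one of [x] and [k] is one of
    [h]; in particular a factor of an antipodal product is antipodal. *)

Set Implicit Arguments.
Unset Strict Implicit.
Unset Printing Implicit Defensive.

(** * Walks and distances *)

Lemma walkP (G : sgraph) n (x y : G) :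
  reflect (exists p, [/\ size p = n, path sedge x p & last x p = y])
          (walk n x y).
Proof.
apply: (iffP existsP) => [[p /andP[xp /eqP py]]|[p [sp xp py]]].
  by exists p; rewrite size_tuple.
have sp' : size p == n by apply/eqP.
by exists (Tuple sp'); rewrite /= xp py /=.
Qed.

Lemma walk0 (G : sgraph) (x y : G) : walk 0 x y = (x == y).
Proof.
apply/walkP/eqP => [[p [/size0nil -> _ <-]] //|<-].
by exists [::].
Qed.

Lemma walkSP (G : sgraph) n (x y : G) :
  reflect (exists2 z, x -- z & walk n z y) (walk n.+1 x y).
Proof.
apply: (iffP (walkP _ _ _)) => [[[|z p] [//= [sp] /andP[xz zp] py]]|[z xz]].
  by exists z => //; apply/walkP; exists p.
case/walkP => p [sp zp py]; exists (z :: p).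
by rewrite /= sp xz zp.
Qed.

Lemma walk1 (G : sgraph) (x y : G) : walk 1 x y = x -- y.
Proof.
apply/walkSP/idP => [[z xz]|xy]; first by rewrite walk0 => /eqP <-.
by exists y; rewrite ?walk0.
Qed.

Lemma walk_trans (G : sgraph) m n (x y z : G) :
  walk m x y -> walk n y z -> walk (m + n) x z.
Proof.
move=> xy yz; elim: m x xy => [|m IHm] x; first by rewrite walk0 => /eqP ->.
by case/walkSP => t xt /IHm tz; rewrite addSn; apply/walkSP; exists t.
Qed.

Lemma walk_homo (G H : sgraph) (f : G -> H) :
  {homo f : x y / x -- y} -> forall n, {homo f : x y / walk n x y}.
Proof.
move=> f_edge; elim=> [|n IHn] x y; first by rewrite !walk0 => /eqP ->.
by case/walkSP => z /f_edge xz /IHn zy; apply/walkSP; exists (f z).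
Qed.

Lemma connect_walkP (G : sgraph) (x y : G) :
  reflect (exists n, walk n x y) (connect sedge x y).
Proof.
apply: (iffP connectP) => [[p xp ->]|[n /walkP[p [_ xp <-]]]]; last by exists p.
by exists (size p); apply/walkP; exists p.
Qed.

Lemma dist_le (G : sgraph) n (x y : G) : walk n x y -> dist x y <= n.
Proof.
(* A failed search returns [#|G|], so [dist] never exceeds [#|G|], and only [n] inside the search
   range needs an argument. *)
move=> xy; rewrite /dist; have [ltn|] := ltnP n #|G|; last first.
  by apply: leq_trans; rewrite -[leqRHS](size_iota 0) find_size.
rewrite leqNgt; apply/negP => /(before_find 0).
by rewrite nth_iota // add0n xy.
Qed.

(** Any walk shortens to one without repeated vertices, which has fewer than [#|G|] edges. The
    bounded search in [dist] therefore succeeds, and its result is the length of an actual walk. *)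
Lemma walk_dist (G : sgraph) n (x y : G) : walk n x y -> walk (dist x y) x y.
Proof.
case/walkP => p [_ xp]; case/shortenP: xp => q xq uq _ qy.
have sq : size q < #|G|.
  by have := card_uniqP uq => /= <-; apply: max_card.
have hq : has (fun n => walk n x y) (iota 0 #|G|).
  apply/hasP; exists (size q); first by rewrite mem_iota.
  by apply/walkP; exists q.
have := nth_find 0 hq; rewrite nth_iota ?add0n //.
by move: hq; rewrite has_find size_iota.
Qed.

Lemma dist_eq (G : sgraph) n (x y : G) :
  walk n x y -> (forall m, walk m x y -> n <= m) -> dist x y = n.
Proof.
move=> xy min_n; apply/eqP; rewrite eqn_leq dist_le //=.
exact: min_n (walk_dist xy).
Qed.

Lemma connected_walk_dist (G : sgraph) (x y : G) :
  connected G -> walk (dist x y) x y.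
Proof. by case=> _ /(_ x y) /connect_walkP[n]; apply: walk_dist. Qed.

Lemma dist_xx (G : sgraph) (x : G) : dist x x = 0.
Proof. by apply/eqP; rewrite -leqn0 dist_le // walk0. Qed.

(** The value of a failed search, [#|G|], is positive because [x] exists. So the value 0 could only
    come from a walk of length 0. *)
Lemma dist_gt0 (G : sgraph) (x y : G) : x != y -> 0 < dist x y.
Proof.
move=> neq_xy; rewrite lt0n; apply: contraNneq neq_xy => d0.
have G_gt0 : 0 < #|G| by apply/card_gt0P; exists x.
have has_walk : has (fun n => walk n x y) (iota 0 #|G|).
  by rewrite has_find size_iota [find _ _]d0.
by have := nth_find 0 has_walk; rewrite [find _ _]d0 nth_iota // walk0.
Qed.

Lemma dist1 (G : sgraph) (x y : G) :
  connected G -> (dist x y == 1) = x -- y.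
Proof.
move=> cG; apply/eqP/idP => [d1|xy].
  by have := connected_walk_dist x y cG; rewrite d1 walk1.
apply: dist_eq => [|[|m] //]; first by rewrite walk1.
by rewrite walk0 => /eqP xy'; rewrite xy' sedge_irrefl in xy.
Qed.

(** * Isomorphisms *)

Lemma isomorphic_refl (G : sgraph) : isomorphic G G.
Proof. by exists id; split; first by exists id. Qed.

Lemma isomorphic_sym (G H : sgraph) : isomorphic G H -> isomorphic H G.
Proof.
case=> f [[g fK gK] f_edge]; exists g; split; first by exists f.
by move=> x y; rewrite -f_edge !gK.
Qed.

Lemma isomorphic_trans (G H K : sgraph) :
  isomorphic G H -> isomorphic H K -> isomorphic G K.
Proof.
case=> f [f_bij f_edge] [g [g_bij g_edge]]; exists (g \o f).
by split=> [|x y]; [apply: bij_comp | rewrite /= g_edge f_edge].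
Qed.

Lemma isomorphic_walk (G H : sgraph) (f : G -> H) n (x y : G) :
  bijective f -> {mono f : x y / x -- y} -> walk n (f x) (f y) = walk n x y.
Proof.
case=> g fK gK f_edge; apply/idP/idP; last first.
  by apply: walk_homo => {}x {}y; rewrite f_edge.
have g_edge : {homo g : u v / u -- v} by move=> u v; rewrite -f_edge !gK.
by move/(walk_homo g_edge); rewrite !fK.
Qed.

Lemma isomorphic_dist (G H : sgraph) (f : G -> H) (x y : G) :
  bijective f -> {mono f : x y / x -- y} -> dist (f x) (f y) = dist x y.
Proof.
move=> f_bij f_edge; rewrite /dist (bij_eq_card f_bij).
by apply: eq_find => n; apply: isomorphic_walk.
Qed.

Lemma isomorphic_connected (G H : sgraph) :
  isomorphic G H -> connected H -> connected G.
Proof.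
case=> f [f_bij f_edge] [H_gt0 H_conn]; split.
  by rewrite (bij_eq_card f_bij).
move=> x y; case/connect_walkP: (H_conn (f x) (f y)) => n.
by rewrite isomorphic_walk // => xy; apply/connect_walkP; exists n.
Qed.

Lemma isomorphic_cartesian (G G' X X' : sgraph) :
  isomorphic G G' -> isomorphic X X' ->
  isomorphic (cartesian_product G X) (cartesian_product G' X').
Proof.
case=> f [f_bij f_edge] [g [g_bij g_edge]].
have f_inj := bij_inj f_bij; have g_inj := bij_inj g_bij.
exists (fun u => (f u.1, g u.2)); split.
  case: f_bij g_bij => f' fK f'K [g' gK g'K].
  by exists (fun u => (f' u.1, g' u.2)) => -[a b] /=; rewrite ?fK ?gK ?f'K ?g'K.
move=> u v; rewrite /= /cartesian_edge /=.
by rewrite f_edge g_edge (inj_eq f_inj) (inj_eq g_inj).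
Qed.

Definition in_induced (G : sgraph) (S : {set G}) (x : G) (Sx : x \in S) :
  induced S := exist _ x Sx.

Lemma induced_edgeE (G : sgraph) (S : {set G}) (x y : induced S) :
  x -- y = val x -- val y.
Proof.
case: x y => [x Sx] [y Sy].
by rewrite /= /sgraph_of_edge /= /induced_edge [x \in S]Sx [y \in S]Sy.
Qed.

(** Semicubes of a product are boxes [setX S T]; rewriting the graphs they induce as products lets
    isomorphisms of the factors be combined. *)
Lemma isomorphic_induced_setX (G X : sgraph) (S : {set G}) (T : {set X}) :
  isomorphic (cartesian_product (induced S) (induced T))
             (@induced (cartesian_product G X) (setX S T)).
Proof.
have in_prod (u : cartesian_product (induced S) (induced T)) :
  (val u.1, val u.2) \in setX S T.
  by rewrite in_setX; apply/andP; split; apply: valP.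
have in1 (w : @induced (cartesian_product G X) (setX S T)) : (val w).1 \in S.
  by have := valP w; rewrite inE => /andP[].
have in2 (w : @induced (cartesian_product G X) (setX S T)) : (val w).2 \in T.
  by have := valP w; rewrite inE => /andP[].
exists (fun u => @in_induced (cartesian_product G X) _ _ (in_prod u)); split.
  exists (fun w => (in_induced (in1 w), in_induced (in2 w))).
    by case=> a b; congr pair; apply: val_inj.
  by move=> w; apply: val_inj => /=; case: (val w).
move=> u v; rewrite induced_edgeE /= /cartesian_edge /=.
by rewrite -!induced_edgeE.
Qed.

(** * Embeddings into hypercubes *)

(** A sum over coordinates rather than a cardinality, so that single coordinates can be extracted
    and blocks of coordinates separated. *)
Definition hamming n (x y : {ffun 'I_n -> bool}) := \sum_i (x i != y i).

Lemma hamming_edge n (x y : hypercube n) : x -- y = (hamming x y == 1).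
Proof.
rewrite /= /hypercube_edge -sum1dep_card big_mkcond.
by congr (_ == 1); apply: eq_bigr => i _; case: (_ != _).
Qed.

Lemma hamming_eq0 n (x y : {ffun 'I_n -> bool}) : (hamming x y == 0) = (x == y).
Proof.
rewrite sum_nat_eq0; apply/forallP/eqP => [xy|-> i]; last by rewrite eqxx.
by apply/ffunP => i; apply/eqP; have := xy i; rewrite eqb0 negbK.
Qed.

Lemma hamming_triangle n (x y z : {ffun 'I_n -> bool}) :
  hamming x z <= hamming x y + hamming y z.
Proof.
rewrite -big_split leq_sum // => i _ /=.
by case: (x i) (y i) (z i) => [] [] [].
Qed.

Lemma hypercube_walk n (x y : hypercube n) : walk (hamming x y) x y.
Proof.
move: {2}(hamming x y) (erefl (hamming x y)) => m.
elim: m x => [|m IHm] x xy.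
  by rewrite xy walk0 -hamming_eq0 xy.
have [i xyi] : exists i, x i != y i.
  apply/existsP; apply: contraPT (xy) => /existsPn eq_xy.
  by rewrite /hamming big1 // => i _; rewrite (negbTE (eq_xy i)).
(* Correcting one differing coordinate of [x] crosses one edge and lowers the Hamming distance to
   [y] by exactly one. *)
pose z : hypercube n := [ffun j => if j == i then y j else x j].
have xz : hamming x z = 1.
  rewrite /hamming (bigD1 i) //= ffunE eqxx xyi big1 // => j /negbTE ji.
  by rewrite ffunE ji eqxx.
have zy : hamming z y = m.
  apply/succn_inj; rewrite -xy /hamming (bigD1 i) //= [RHS](bigD1 i) //=.
  rewrite ffunE !eqxx xyi /= add0n add1n; congr _.+1.
  by apply: eq_bigr => j /negbTE ji; rewrite ffunE ji.
rewrite xy; apply/walkSP; exists z; first by rewrite hamming_edge xz.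
by rewrite -zy IHm.
Qed.

Lemma dist_hypercube n (x y : hypercube n) : dist x y = hamming x y.
Proof.
apply: dist_eq; first exact: hypercube_walk.
(* No walk is shorter, since each edge changes the Hamming distance to [y] by at most one. *)
move=> m; elim: m x => [|m IHm] x.
  by rewrite walk0 leqn0 hamming_eq0.
case/walkSP => z xz /IHm zy; apply: leq_trans (hamming_triangle x z y) _.
by move: xz; rewrite hamming_edge => /eqP ->.
Qed.

(** Trades the isometric subgraph for a distance-preserving labelling of the vertices by bit
    vectors, a form in which labellings of two factors can be concatenated. *)
Lemma partial_cubeP (G : sgraph) :
  partial_cube G <->
  connected G /\ exists n (f : G -> {ffun 'I_n -> bool}),
    forall x y, hamming (f x) (f y) = dist x y.
Proof.
split=> [[n [H [H_conn H_isom G_iso]]]|[G_conn [n [f f_isom]]]].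
  split; first exact: isomorphic_connected G_iso H_conn.
  case: G_iso => f [f_bij f_edge]; exists n, (fun x => val (f x)) => x y.
  by rewrite -dist_hypercube -H_isom isomorphic_dist.
have f_inj : injective f.
  move=> x y /eqP; rewrite -hamming_eq0 f_isom => /eqP d0; apply/eqP.
  by apply: contra_eqT d0 => /dist_gt0; rewrite lt0n.
(* The subgraph induced on the image of the labelling has the right edges: in both graphs adjacency
   means distance 1. *)
pose S : {set hypercube n} := [set f x | x in G].
have fS x : f x \in S by apply: imset_f.
pose g x : induced S := in_induced (fS x).
have g_bij : bijective g.
  apply: inj_card_bij => [x y /(congr1 val)|]; first exact: f_inj.
  rewrite card_sig -(card_imset G f_inj); apply: subset_leq_card.
  exact/subsetP.
have g_edge : {mono g : x y / x -- y}.
  by move=> x y; rewrite induced_edgeE hamming_edge f_isom dist1.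
have g_iso : isomorphic G (induced S) by exists g.
exists n, (Subgraph (@induced_edge_sym _ S) (@induced_edgeP _ S)); split=> //.
  exact: isomorphic_connected (isomorphic_sym g_iso) G_conn.
(* Every vertex of the induced subgraph is the label of a vertex of [G], so its distances can be
   computed in [G], where they agree with the Hamming distance. *)
case: (g_bij) => g' _ g'K u v; rewrite -(g'K u) -(g'K v).
by rewrite [LHS]isomorphic_dist // dist_hypercube f_isom.
Qed.

(** * The Cartesian product *)

Lemma cartesian_walk (G X : sgraph) m n (x y : G) (h k : X) :
  walk m x y -> walk n h k ->
  @walk (cartesian_product G X) (m + n) (x, h) (y, k).
Proof.
(* Walk first within the copy of [G] at [h], then within the copy of [X] at [y]. *)
move=> xy hk; apply: (@walk_trans (cartesian_product G X) _ _ _ (y, h)).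
  apply: (@walk_homo _ (cartesian_product G X) (fun a => (a, h))) xy => a b ab.
  by rewrite /= /cartesian_edge /= ab eqxx.
apply: (@walk_homo _ (cartesian_product G X) (fun a => (y, a))) hk => a b ab.
by rewrite /= /cartesian_edge /= ab eqxx orbT.
Qed.

(** Each edge of the product moves exactly one coordinate, so [a] and [b] count the steps made in
    either factor. This gives the lower bound on distances in the product. *)
Lemma cartesian_walk_split (G X : sgraph) n (u v : cartesian_product G X) :
  walk n u v -> exists a b, [/\ a + b = n, walk a u.1 v.1 & walk b u.2 v.2].
Proof.
elim: n u => [|n IHn] u.
  by rewrite walk0 => /eqP ->; exists 0, 0; rewrite !walk0 !eqxx.
case/walkSP => w uw /IHn[a [b [<- wv1 wv2]]].
case/orP: uw => /andP[].
  move=> uw /eqP ->; exists a.+1, b; split=> //.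
  by apply/walkSP; exists w.1.
move=> /eqP -> uw; exists a, b.+1; split=> //; first by rewrite addnS.
by apply/walkSP; exists w.2.
Qed.

Lemma dist_cartesian (G X : sgraph) (u v : cartesian_product G X) :
  connected G -> connected X -> dist u v = dist u.1 v.1 + dist u.2 v.2.
Proof.
case: u v => x h [y k] G_conn X_conn; apply: dist_eq.
  by apply: cartesian_walk; apply: connected_walk_dist.
move=> m /cartesian_walk_split[a [b [<- xy hk]]].
by apply: leq_add; apply: dist_le.
Qed.

Lemma connected_cartesian (G X : sgraph) :
  connected G -> connected X -> connected (cartesian_product G X).
Proof.
move=> G_conn X_conn; split; last first.
  move=> [x h] [y k]; apply/connect_walkP; exists (dist x y + dist h k).
  by apply: cartesian_walk; apply: connected_walk_dist.
by case: G_conn X_conn => G_gt0 _ [X_gt0 _]; rewrite card_prod muln_gt0 G_gt0.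
Qed.

Lemma partial_cube_cartesian (G X : sgraph) :
  partial_cube G -> partial_cube X -> partial_cube (cartesian_product G X).
Proof.
case/partial_cubeP => G_conn [m [f f_isom]].
case/partial_cubeP => X_conn [n [g g_isom]].
apply/partial_cubeP; split; first exact: connected_cartesian.
exists (m + n), (fun u => [ffun i =>
  match split i with inl j => f u.1 j | inr k => g u.2 k end]) => u v.
rewrite dist_cartesian // -f_isom -g_isom /hamming big_split_ord /=.
congr (_ + _); apply: eq_bigr => i _; rewrite !ffunE.
  (* Seeing the shifted index as an [unsplit] lets [split] reduce and select the right block. *)
  by rewrite -[lshift n i]/(unsplit (inl i)) unsplitK.
by rewrite -[rshift m i]/(unsplit (inr i)) unsplitK.
Qed.

(** Replaces Theta-classes by edges. Each edge lies in the class it generates, because it is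
    Theta-related to itself: 0 + 0 differs from twice a positive distance. Conversely, all members
    of a class are edges. *)
Lemma opposite_semicube_isomorphicP (G : sgraph) :
  opposite_semicube_isomorphic G <->
  forall x y : G, x -- y ->
    isomorphic (induced (semicube x y)) (induced (semicube y x)).
Proof.
split=> [osiG x y xy|osiG E /imsetP[e _ ->] x y].
  have xyG : [set x; y] \in edges G by apply/imsetP; exists (x, y); rewrite ?inE.
  apply: (osiG _ (imset_f _ xyG)); rewrite inE xyG /=.
  have neq_xy : x != y by apply: contraTneq xy => ->; rewrite sedge_irrefl.
  apply/existsP; exists x; apply/existsP; exists y.
  apply/existsP; exists x; apply/existsP; exists y.
  by rewrite !eqxx !dist_xx eq_sym -lt0n addn_gt0 dist_gt0.
rewrite inE => /andP[/imsetP[[a b]]]; rewrite inE /= => ab xy_ab _.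
(* Equality of the unordered pairs, tested at all four vertices, leaves only the two orientations of
   the edge [ab]; the degenerate cases contradict [a != b]. *)
apply: osiG; have /setP xyE := xy_ab.
move: (xyE x) (xyE y) (xyE a) (xyE b); rewrite !inE !eqxx !orbT /=.
have neq_ab : a != b by apply: contraTneq ab => ->; rewrite sedge_irrefl.
case/esym/orP => /eqP -> /esym/orP[] /eqP ->; rewrite ?eqxx ?orbb //.
- by rewrite [b == a]eq_sym (negbTE neq_ab).
- by rewrite sedge_sym.
- by rewrite (negbTE neq_ab).
Qed.

(** The distance in [X] to the common coordinate [h] occurs on both sides of the comparison and
    cancels. *)
Lemma semicube_cartesianl (G X : sgraph) (x y : G) (h : X) :
  connected G -> connected X ->
  @semicube (cartesian_product G X) (x, h) (y, h) = setX (semicube x y) setT.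
Proof.
move=> G_conn X_conn; apply/setP => u.
by rewrite !inE !dist_cartesian //= ltn_add2r andbT.
Qed.

Lemma semicube_cartesianr (G X : sgraph) (x : G) (h k : X) :
  connected G -> connected X ->
  @semicube (cartesian_product G X) (x, h) (x, k) = setX setT (semicube h k).
Proof.
move=> G_conn X_conn; apply/setP => u.
by rewrite !inE !dist_cartesian //= ltn_add2l.
Qed.

Lemma isomorphic_setX (G X : sgraph) (S S' : {set G}) (T T' : {set X}) :
  isomorphic (induced S) (induced S') -> isomorphic (induced T) (induced T') ->
  isomorphic (@induced (cartesian_product G X) (setX S T))
             (@induced (cartesian_product G X) (setX S' T')).
Proof.
move=> S_iso T_iso.
apply: isomorphic_trans (isomorphic_sym (isomorphic_induced_setX S T)) _.
apply: isomorphic_trans (isomorphic_induced_setX S' T').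
exact: isomorphic_cartesian.
Qed.

Lemma opposite_semicube_isomorphic_cartesian (G X : sgraph) :
  connected G -> connected X ->
  opposite_semicube_isomorphic G -> opposite_semicube_isomorphic X ->
  opposite_semicube_isomorphic (cartesian_product G X).
Proof.
move=> G_conn X_conn /opposite_semicube_isomorphicP osiG.
move=> /opposite_semicube_isomorphicP osiX.
apply/opposite_semicube_isomorphicP => -[x h] [y k].
case/orP => /= /andP[].
  move=> xy /eqP <-; rewrite !semicube_cartesianl //.
  exact: isomorphic_setX (osiG _ _ xy) (isomorphic_refl _).
move=> /eqP <- hk; rewrite !semicube_cartesianr //.
exact: isomorphic_setX (isomorphic_refl _) (osiX _ _ hk).
Qed.

(** A neighbor of [(y, k)] differs from it in one coordinate only, so the contribution of the other
    coordinate cancels and the condition splits into one for each factor. *)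
Lemma relative_antipode_cartesian (G X : sgraph) (x y : G) (h k : X) :
  connected G -> connected X ->
  @relative_antipode (cartesian_product G X) (x, h) (y, k) <->
  relative_antipode x y /\ relative_antipode h k.
Proof.
move=> G_conn X_conn; split=> [yk|[xy hk] [z l]].
  split=> [z yz|l kl].
    have := yk (z, k); rewrite !dist_cartesian //= leq_add2r; apply.
    by rewrite /cartesian_edge /= yz eqxx.
  have := yk (y, l); rewrite !dist_cartesian //= leq_add2l; apply.
  by rewrite /cartesian_edge /= kl eqxx orbT.
rewrite !dist_cartesian //=; case/orP => /= /andP[].
  by move=> yz /eqP <-; rewrite leq_add2r xy.
by move=> /eqP <- kl; rewrite leq_add2l hk.
Qed.

Lemma antipodal_cartesianl (G X : sgraph) :
  connected G -> connected X ->
  antipodal (cartesian_product G X) -> antipodal G.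
Proof.
(* Connectedness includes nonemptiness, which supplies a base vertex [h] of [X]. For any relative
   antipode [z] of [x], the pair [(z, k)] is one of [(x, h)], so uniqueness in the product forces
   [z = y]. *)
move=> G_conn X_conn anti x; have [/card_gt0P[h _] _] := X_conn.
have [[y k] [/relative_antipode_cartesian[] // xy hk uniq_yk]] := anti (x, h).
exists y; split=> // z xz.
have /uniq_yk[] // : @relative_antipode (cartesian_product G X) (x, h) (z, k).
exact/relative_antipode_cartesian.
Qed.

Theorem theorem4p2 (G X : sgraph)
    (pcG : partial_cube G)
    (osiG : opposite_semicube_isomorphic G)
    (not_antipodalG : ~ antipodal G)
    (pcX : partial_cube X)
    (osiX : opposite_semicube_isomorphic X)
    (antipodalX : antipodal X) :
  [/\ partial_cube (cartesian_product G X),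
      opposite_semicube_isomorphic (cartesian_product G X)
    & ~ antipodal (cartesian_product G X)].
Proof.
have [[G_conn _] [X_conn _]] := ((partial_cubeP G).1 pcG, (partial_cubeP X).1 pcX).
split.
- exact: partial_cube_cartesian.
- exact: opposite_semicube_isomorphic_cartesian.
- by move/(antipodal_cartesianl G_conn X_conn).
Qed.
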